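(* Let $P_m$ be the path graph on $m \geq 4$ vertices, with adjacency matrix $A$, and let $u,v$ be its two endpoints. For every real diagonal matrix $Q$ (a potential on the vertices), there is no time $T\in\mathbb{R}$ at which perfect state transfer from $u$ to $v$ occurs for the Hamiltonian $H = A - Q$.
   Context: For a graph $G$ with adjacency matrix $A$ and a real diagonal matrix $Q$ (the potential, whose diagonal entries are real values assigned to the vertices), the Hamiltonian is $H = A - Q$ and $U(t) = e^{itH}$. Perfect state transfer from vertex $u$ to vertex $v$ occurs at time $T$ if $|U(T)_{u,v}| = 1$, equivalently $U(T)\mathbf{1}_u = \gamma \mathbf{1}_v$ for some $\gamma\in\mathbb{C}$ with $|\gamma|=1$, where $\mathbf{1}_w$ is the indicator vector of vertex $w$. Here ''path of length $m$'' means the path on $m$ vertices. *)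

(* Defs.v *)
From HB Require Import structures.
From mathcomp Require Import all_boot all_order all_algebra.
From mathcomp Require Import complex.
From mathcomp Require Import all_classical all_reals all_analysis.
Set Implicit Arguments. Unset Strict Implicit. Unset Printing Implicit Defensive.
Import Order.TTheory GRing.Theory Num.Theory.
Import numFieldNormedType.Exports.
Local Open Scope ring_scope.
Local Open Scope complex_scope.

Definition path_adj (R : ringType) (m : nat) : 'M[R]_m :=
  \matrix_(i < m, j < m) (((i.+1 == j :> nat) || (j.+1 == i :> nat))%:R).

Definition expmx (R : realType) (n : nat) (A : 'M[R[i]]_n) : 'M[R[i]]_n :=
  limn (series (fun k : nat => (k`!%:R)^-1 *: A ^+ k)).

Definition hamiltonian (R : realType) (m : nat) (Q : 'M[R]_m) : 'M[R[i]]_m :=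
  map_mx (fun x : R => x%:C) (path_adj R m - Q).

Definition evol (R : realType) (m : nat) (Q : 'M[R]_m) (t : R) : 'M[R[i]]_m :=
  expmx (('i * t%:C) *: hamiltonian Q).

Definition PST (R : realType) (m : nat) (Q : 'M[R]_m) (u v : 'I_m) (T : R) : Prop :=
  `| evol Q T u v | = 1.

(* Main.v *)
Require Import Defs.
From HB Require Import structures.
From mathcomp Require Import all_boot all_order all_algebra.
From mathcomp Require Import complex.
From mathcomp Require Import all_classical all_reals all_analysis.
From mathcomp Require Import ring lra zify.
Import Order.TTheory GRing.Theory Num.Theory.
Import numFieldNormedType.Exports.
Local Open Scope ring_scope.

(** Suppose transfer occurs at time [T].  Since [U = exp (i T H)] is unitary,
    commutes with the tridiagonal [H] and has a corner entry [gam] of modulus 1,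
    propagating along rows gives [U = gam F] with [F] the reflection of the path,
    and the potential is mirror symmetric.  Let [jac n] be the characteristic
    polynomial of the first [n - 1] vertices.  The symmetric and antisymmetric
    eigenvalues are the roots of two explicit polynomials of degree about [m / 2]
    built from consecutive [jac]'s, and [exp (i T l) = gam], resp. [- gam], on
    them; so differences of eigenvalues of opposite (resp. equal) symmetry are
    odd (resp. even) multiples of [d = pi / T].
    With [k = m / 2 >= 2], the resultant of the two polynomials is [2 ^ k] up to
    sign.  If [m = 2k], the sums of the roots differ by 2, so [d N = 2] with [N]
    an integer and [d ^ (k^2) O = 2 ^ k] with [O] odd.  If [m = 2k + 1], the sums
    of the squares of the roots, centered at the middle potential, differ by 4,
    so [d^2 M = 4] and [d ^ (k (k + 1)) O = 2 ^ k].  Both are impossible by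
    comparing 2-adic valuations. *)

Set Implicit Arguments.
Unset Strict Implicit.
Unset Printing Implicit Defensive.

(** * Jacobi polynomials *)

Section JacobiPolynomials.
Variables (C : numClosedFieldType) (h : nat -> C).

(* [jac n.+1] is the characteristic polynomial of the [n x n] Jacobi matrix with
   diagonal [h] and off-diagonal entries 1; the shift allows [jac 0 = 0]. *)
Fixpoint jac (n : nat) : {poly C} :=
  if n is n'.+1 then
    if n' is n''.+1 then ('X - (h n'')%:P) * jac n' - jac n'' else 1
  else 0.

Lemma jacSS n : jac n.+2 = ('X - (h n)%:P) * jac n.+1 - jac n.
Proof. by []. Qed.

Lemma horner_jacSS n x :
  (jac n.+2).[x] = (x - h n) * (jac n.+1).[x] - (jac n).[x].
Proof. by rewrite jacSS hornerD hornerN hornerM hornerXsubC. Qed.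

Lemma size_jac n : size (jac n) = n.
Proof.
suff : size (jac n) = n /\ size (jac n.+1) = n.+1 by case.
elim: n => [|n [sn sSn]]; first by rewrite size_poly0 size_poly1.
have jn0 : jac n.+1 != 0 by rewrite -size_poly_eq0 sSn.
by rewrite jacSS size_polyDl size_monicM ?monicXsubC // sSn size_XsubC // size_polyN sn.
Qed.

Lemma jac_monic n : jac n.+1 \is monic.
Proof.
elim: n => [|n IHn]; first exact: monic1.
rewrite monicE jacSS lead_coefDl.
  by rewrite lead_coef_monicM ?monicXsubC ?(monicP IHn).
rewrite size_polyN size_monicM ?monicXsubC ?size_XsubC ?size_jac //.
by rewrite -size_poly_eq0 size_jac.
Qed.

Lemma monic_split (p : {poly C}) : p \is monic ->
  {s : seq C | p = \prod_(a <- s) ('X - a%:P) & size s = (size p).-1}.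
Proof.
move=> p_monic; have [s pE] := closed_field_poly_normal p.
rewrite (monicP p_monic) scale1r in pE.
by exists s => //; rewrite pE size_prod_XsubC.
Qed.

(** * Resultants up to sign *)

Lemma norm_prod_eq (s : seq C) (f g : C -> C) :
  {in s, forall a, `|f a| = `|g a|} ->
  `|\prod_(a <- s) f a| = `|\prod_(a <- s) g a|.
Proof. by move=> fg; rewrite !normr_prod; apply: eq_big_seq. Qed.

(** Both sides are the resultant, the double product of the differences of roots, up to sign.
    Absolute values discard that sign throughout. *)
Lemma norm_res_sym (s t : seq C) :
  `|\prod_(a <- s) (\prod_(b <- t) ('X - b%:P)).[a]| =
  `|\prod_(b <- t) (\prod_(a <- s) ('X - a%:P)).[b]|.
Proof.
under eq_bigr do rewrite horner_prod.
under [in RHS]eq_bigr do rewrite horner_prod.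
rewrite exchange_big !normr_prod /=; apply: eq_bigr => b _.
rewrite !normr_prod; apply: eq_bigr => a _.
by rewrite !hornerXsubC distrC.
Qed.

(** Modulo [jac n.+1] the recurrence reads [jac n.+2 = - jac n], so exchanging the two root sets
    lowers the index of a consecutive pair, down to the constant [jac 1 = 1]. *)
Lemma norm_res_jac n (s : seq C) : jac n.+1 = \prod_(a <- s) ('X - a%:P) ->
  `|\prod_(a <- s) (jac n).[a]| = 1.
Proof.
elim: n s => [|n IHn] s sE.
  have/eqP : size s = 0%N.
    by apply: succn_inj; rewrite -(size_prod_XsubC s id) -sE size_jac.
  by rewrite size_eq0 => /eqP ->; rewrite big_nil normr1.
have [t tE _] := monic_split (jac_monic n).
rewrite {1}tE norm_res_sym -sE; apply: etrans (IHn t tE).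
apply: norm_prod_eq => b b_t; rewrite jacSS hornerD hornerN hornerM.
have /rootP -> : root (jac n.+1) b by rewrite tE root_prod_XsubC.
by rewrite mulr0 add0r normrN.
Qed.

(** At a root of the difference, the sum equals [2 * jac k]. The factors 2 come out, and the rest is
    a resultant with [jac k], for which the difference may be replaced by [jac k.+1]. *)
Lemma norm_res_even k (s t : seq C) :
  jac k.+1 - jac k = \prod_(a <- s) ('X - a%:P) ->
  jac k.+1 + jac k = \prod_(b <- t) ('X - b%:P) ->
  `|\prod_(a <- s) \prod_(b <- t) (a - b)| = 2 ^+ size s.
Proof.
move=> sE tE.
have tEa a : a \in s -> (\prod_(b <- t) ('X - b%:P)).[a] = 2 * (jac k).[a].
  rewrite -root_prod_XsubC -sE => /rootP; rewrite hornerD hornerN => /subr0_eq jE.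
  by rewrite -tE hornerD jE mulr_natl.
have -> : \prod_(a <- s) \prod_(b <- t) (a - b) = \prod_(a <- s) (2 * (jac k).[a]).
  apply: eq_big_seq => a a_s.
  by rewrite -tEa // horner_prod; apply: eq_bigr => b _; rewrite hornerXsubC.
rewrite big_split /= big_const_seq count_predT iter_mulr_1 normrM normrX normr_nat.
rewrite -[RHS]mulr1; congr (_ * _).
case: k sE {tE tEa} => [|k] sE.
  have/eqP : size s = 0%N.
    by apply: succn_inj; rewrite -(size_prod_XsubC s id) -sE subr0 size_jac.
  by rewrite size_eq0 => /eqP ->; rewrite big_nil normr1.
have [r rE _] := monic_split (jac_monic k); have [u uE _] := monic_split (jac_monic k.+1).
apply: etrans (norm_res_jac uE); rewrite rE norm_res_sym [RHS]norm_res_sym -sE -uE.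
apply: norm_prod_eq => b b_r; rewrite hornerD hornerN.
have /rootP -> : root (jac k.+1) b by rewrite rE root_prod_XsubC.
by rewrite oppr0 addr0.
Qed.

(** At a root of [jac k.+1] the recurrence gives [jac k.+2 = - jac k], so the first polynomial takes
    the value [- 2 * jac k]. *)
Lemma norm_res_odd k (s t : seq C) :
  jac k.+2 - jac k = \prod_(a <- s) ('X - a%:P) ->
  jac k.+1 = \prod_(b <- t) ('X - b%:P) ->
  `|\prod_(a <- s) \prod_(b <- t) (a - b)| = 2 ^+ size t.
Proof.
move=> sE tE; rewrite exchange_big /=.
have -> : `|\prod_(b <- t) \prod_(a <- s) (a - b)| = `|\prod_(b <- t) (2 * (jac k).[b])|.
  apply: norm_prod_eq => b b_t.
  have -> : 2 * (jac k).[b] = - (\prod_(a <- s) ('X - a%:P)).[b].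
    have /rootP jb : root (jac k.+1) b by rewrite tE root_prod_XsubC.
    by rewrite -sE jacSS !hornerE jb; ring.
  rewrite normrN horner_prod !normr_prod; apply: eq_bigr => a _.
  by rewrite hornerXsubC distrC.
rewrite big_split /= big_const_seq count_predT iter_mulr_1 normrM normrX normr_nat.
by rewrite (norm_res_jac tE) mulr1.
Qed.

(** * Power sums of the roots *)

Lemma sum_even k (s t : seq C) :
  jac k.+2 - jac k.+1 = \prod_(a <- s) ('X - a%:P) ->
  jac k.+2 + jac k.+1 = \prod_(b <- t) ('X - b%:P) ->
  size s = k.+1 -> size t = k.+1 ->
  \sum_(a <- s) a - \sum_(b <- t) b = 2.
Proof.
move=> sE tE ss st.
have := coefPn_prod_XsubC (ps := s); have := coefPn_prod_XsubC (ps := t).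
rewrite ss st -sE -tE /= !coefD !coefN => /(_ isT) t1 /(_ isT) s1.
(* The two polynomials differ by [2 * jac k.+1], with [jac k.+1] monic of degree [k]: their
   subleading coefficients differ by exactly 2. *)
have : (jac k.+1)`_k = 1 by have /monicP := jac_monic k; rewrite lead_coefE size_jac.
move=> j1; rewrite -[\sum_(a <- s) a]opprK -s1 -[in X in _ + X]t1 j1; ring.
Qed.

(** Newton's identity [2 e_2 = p_1 ^ 2 - p_2]. *)
Lemma coefPn2_prod_XsubC n (s : seq C) : size s = n.+2 ->
  2 * (\prod_(a <- s) ('X - a%:P))`_n = (\sum_(a <- s) a) ^+ 2 - \sum_(a <- s) a ^+ 2.
Proof.
elim: s n => [//|a s IHs] n [ss].
have s1 := coefPn_prod_XsubC (ps := s); rewrite ss in s1; move/(_ isT): s1 => /= s1.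
rewrite !big_cons mulrBl coefB coefXM coefCM s1.
case: n ss {s1} => [|n] ss /=.
  by case: s ss {IHs} => [|b []] // _; rewrite !big_seq1; ring.
by rewrite mulrDr IHs //; ring.
Qed.

(** The first polynomial is [('X - h k.+2) * jac k.+3 - 2 * jac k.+2]. The correction starts two
    degrees below the top, so it leaves [e_1] alone and lowers [e_2] by 2, which raises [p_2] by
    4. *)
Lemma sum_odd k (s t : seq C) :
  jac k.+4 - jac k.+2 = \prod_(a <- s) ('X - a%:P) ->
  jac k.+3 = \prod_(b <- t) ('X - b%:P) ->
  size s = k.+3 -> size t = k.+2 ->
  \sum_(a <- s) a = \sum_(b <- t) b + h k.+2 /\
  \sum_(a <- s) a ^+ 2 = \sum_(b <- t) b ^+ 2 + h k.+2 ^+ 2 + 4.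
Proof.
have jn n : (jac n.+1)`_n = 1.
  by have /monicP := jac_monic n; rewrite lead_coefE size_jac.
have j0 n : (jac n)`_n = 0 by rewrite nth_default ?size_jac.
rewrite jacSS mulrBl; move: (jn k.+2) (jn k.+1) (j0 k.+2) => {jn j0}.
move: (jac k.+3) (jac k.+2) => q r q1 r1 r0 sE tE ss st.
have := coefPn_prod_XsubC (ps := t); rewrite st -tE => /(_ isT) /= t1.
have := coefPn_prod_XsubC (ps := s).
rewrite ss -sE !(coefB, coefXM, coefCM) /= t1 q1 r0 => /(_ isT) s1.
have s1' : \sum_(a <- s) a = \sum_(b <- t) b + h k.+2.
  by rewrite -[LHS]opprK -s1; ring.
split=> //.
have := coefPn2_prod_XsubC ss; have := coefPn2_prod_XsubC st.
rewrite -sE -tE !(coefB, coefXM, coefCM) /= t1 r1 s1' => t2 s2.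
have -> : \sum_(a <- s) a ^+ 2 = (\sum_(b <- t) b + h k.+2) ^+ 2 -
  ((\sum_(b <- t) b + h k.+2) ^+ 2 - \sum_(a <- s) a ^+ 2) by ring.
rewrite -s2.
have -> : \sum_(b <- t) b ^+ 2 = (\sum_(b <- t) b) ^+ 2 -
  ((\sum_(b <- t) b) ^+ 2 - \sum_(b <- t) b ^+ 2) by ring.
by rewrite -t2; ring.
Qed.

(** * Roots in arithmetic progressions *)

Lemma seq_preimage (T : eqType) (U : Type) (f : U -> T) (s : seq T) :
  (forall a, a \in s -> exists n, a = f n) -> exists ns, s = map f ns.
Proof.
elim: s => [|a s IHs] sP; first by exists [::].
have [n aE] := sP a (mem_head _ _).
have [b b_s|ns ->] := IHs; first by apply: sP; rewrite inE b_s orbT.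
by exists (n :: ns); rewrite aE.
Qed.

(** Each difference is [d] times an odd integer, and oddness survives products. *)
Lemma norm_prod_odd (x0 d : C) (ms ns : seq int) :
  exists2 m : nat, odd m &
  `|\prod_(a <- [seq x0 + d * (2 * n + 1)%:~R | n <- ms])
     \prod_(b <- [seq x0 + d * (2 * n)%:~R | n <- ns]) (a - b)| =
  `|d| ^+ (size ms * size ns) * m%:R.
Proof.
rewrite big_map; elim: ms => [|a ms [m m_odd IHm]].
  by exists 1%N; rewrite // big_nil normr1 mul0n mul1r.
rewrite big_cons normrM IHm big_map.
have [p p_odd ->] : exists2 p : nat, odd p &
    `|\prod_(b <- ns) (x0 + d * (2 * a + 1)%:~R - (x0 + d * (2 * b)%:~R))| =
    `|d| ^+ size ns * p%:R.
  elim: ns {IHm} => [|b ns [p p_odd IHp]].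
    by exists 1%N; rewrite // big_nil normr1 mul1r.
  rewrite big_cons normrM IHp.
  have -> : x0 + d * (2 * a + 1)%:~R - (x0 + d * (2 * b)%:~R) =
      d * (2 * (a - b) + 1)%:~R by rewrite !(rmorphD, rmorphM, rmorphB) /=; ring.
  exists (absz (2 * (a - b) + 1)%R * p)%N; first by rewrite oddM p_odd andbT; lia.
  by rewrite normrM -intr_norm -abszE -pmulrn natrM exprS; ring.
exists (p * m)%N; first by rewrite oddM p_odd.
by rewrite natrM mulSn exprD; ring.
Qed.

Lemma sum_progression (x0 d : C) (f : int -> int) (ns : seq int) :
  \sum_(a <- [seq x0 + d * (f n)%:~R | n <- ns]) a =
  x0 *+ size ns + d * (\sum_(n <- ns) f n)%:~R.
Proof.
rewrite big_map big_split /= big_const_seq count_predT iter_addr_0.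
by rewrite -mulr_sumr rmorph_sum.
Qed.

(** Eliminating [d] between the sum of the roots and the resultant leaves an equation in naturals.
    Its 2-adic valuations read [k^2 = k^2 v + k], which has no solution for [k > 1]; [k = 1],
    [v = 0] would be one, and two vertices do allow transfer. *)
Lemma no_progression_even k (x0 d : C) : (1 < k)%N ->
  (forall a, root (jac k.+1 - jac k) a -> exists n : int, a = x0 + d * (2 * n + 1)%:~R) ->
  (forall b, root (jac k.+1 + jac k) b -> exists n : int, b = x0 + d * (2 * n)%:~R) ->
  False.
Proof.
case: k => [//|[//|k]] _ sP tP.
have szlt : (size (jac k.+2) < size (jac k.+3))%N by rewrite !size_jac.
have szltN : (size (- jac k.+2) < size (jac k.+3))%N by rewrite size_polyN.
have [|s sE ss] := @monic_split (jac k.+3 - jac k.+2).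
  by rewrite monicE lead_coefDl // (monicP (jac_monic _)).
have [|t tE st] := @monic_split (jac k.+3 + jac k.+2).
  by rewrite monicE lead_coefDl // (monicP (jac_monic _)).
rewrite size_polyDl // size_jac /= in ss; rewrite size_polyDl // size_jac /= in st.
have r2 := norm_res_even sE tE; have s2 := sum_even sE tE ss st.
have [ms smE] : exists ms, s = [seq x0 + d * (2 * n + 1)%:~R | n <- ms].
  by apply: seq_preimage => a; rewrite -root_prod_XsubC -sE; exact: sP.
have [ns tnE] : exists ns, t = [seq x0 + d * (2 * n)%:~R | n <- ns].
  by apply: seq_preimage => a; rewrite -root_prod_XsubC -tE; exact: tP.
have [m m_odd mE] := norm_prod_odd x0 d ms ns.
have sms : size ms = k.+2 by rewrite -ss smE size_map.
have sns : size ns = k.+2 by rewrite -st tnE size_map.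
rewrite smE tnE mE -smE ss sms sns in r2.
rewrite smE tnE !sum_progression sms sns in s2.
set M := \sum_(n <- ms) _ in s2; set N := \sum_(n <- ns) _ in s2.
have {}s2 : d * (M - N)%:~R = 2 by rewrite -s2 rmorphB /=; ring.
set K := (k.+2 * k.+2)%N in r2.
have key : (2 ^ K * m = absz (M - N)%R ^ K * 2 ^ k.+2)%N.
  apply/eqP; rewrite -(eqr_nat C) natrM [X in _ == X]natrM !natrX -r2.
  rewrite -[X in X ^+ _ * _](@normr_nat C 2) -s2.
  by rewrite normrM -intr_norm -abszE -pmulrn exprMn; apply/eqP; ring.
have M0 : (0 < absz (M - N)%R)%N.
  rewrite absz_gt0; apply/negP => /eqP MN; move: s2; rewrite MN mulr0 => /eqP.
  by rewrite eq_sym pnatr_eq0.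
have m0 : (0 < m)%N by case: m m_odd {mE r2 key}.
move/(congr1 (logn 2)): key.
rewrite lognM ?expn_gt0 // [in RHS]lognM ?expn_gt0 ?M0 // !lognX.
rewrite logn_prime // lognE m0 dvdn2 m_odd /=.
by rewrite /K; case: (logn _ _) => [|v]; nia.
Qed.

(** First power sums only place the middle potential [h k] at [x0] plus an integer multiple of [d].
    Second ones, centered at [h k], give [d^2 M = 4]. The valuations then read
    [2k(k+1) = k(k+1) v + 2k], impossible for [k > 1]. *)
Lemma no_progression_odd k (x0 d : C) : (1 < k)%N ->
  (forall a, root (jac k.+2 - jac k) a -> exists n : int, a = x0 + d * (2 * n + 1)%:~R) ->
  (forall b, root (jac k.+1) b -> exists n : int, b = x0 + d * (2 * n)%:~R) ->
  False.
Proof.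
case: k => [//|[//|k]] _ sP tP.
have szlt : (size (- jac k.+2) < size (jac k.+4))%N by rewrite size_polyN !size_jac.
have [|s sE ss] := @monic_split (jac k.+4 - jac k.+2).
  by rewrite monicE lead_coefDl // (monicP (jac_monic _)).
have [t tE st] := monic_split (jac_monic k.+2).
rewrite size_polyDl // size_jac /= in ss; rewrite size_jac /= in st.
have r2 := norm_res_odd sE tE; have [s1 s2] := sum_odd sE tE ss st.
have [ms smE] : exists ms, s = [seq x0 + d * (2 * n + 1)%:~R | n <- ms].
  by apply: seq_preimage => a; rewrite -root_prod_XsubC -sE; exact: sP.
have [ns tnE] : exists ns, t = [seq x0 + d * (2 * n)%:~R | n <- ns].
  by apply: seq_preimage => a; rewrite -root_prod_XsubC -tE; exact: tP.
have [m m_odd mE] := norm_prod_odd x0 d ms ns.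
have sms : size ms = k.+3 by rewrite -ss smE size_map.
have sns : size ns = k.+2 by rewrite -st tnE size_map.
rewrite smE tnE mE -tnE st sms sns in r2.
have hE : h k.+2 = x0 + d * (\sum_(n <- ms) (2 * n + 1) - \sum_(n <- ns) (2 * n))%:~R.
  have -> : h k.+2 = \sum_(a <- s) a - \sum_(b <- t) b by rewrite s1; ring.
  rewrite smE tnE !sum_progression sms sns rmorphB /=; ring.
set N := (X in X%:~R) in hE.
have {}s2 : \sum_(a <- s) (a - h k.+2) ^+ 2 - \sum_(b <- t) (b - h k.+2) ^+ 2 = 4.
  have sq (r : seq C) : \sum_(a <- r) (a - h k.+2) ^+ 2 =
      \sum_(a <- r) a ^+ 2 - 2 * h k.+2 * \sum_(a <- r) a + h k.+2 ^+ 2 *+ size r.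
    elim: r => [|a r IHr]; first by rewrite !big_nil mulr0 subrr addr0.
    by rewrite !big_cons IHr /= (mulrS _ (size r)); ring.
  by rewrite !sq ss st s2 s1; ring.
have [M M4] : exists M : int, d ^+ 2 * M%:~R = 4.
  exists (\sum_(n <- ms) (2 * n + 1 - N) ^+ 2 - \sum_(n <- ns) (2 * n - N) ^+ 2).
  rewrite -s2 smE tnE !big_map rmorphB !rmorph_sum mulrBr !mulr_sumr /= hE.
  by congr (_ - _); apply: eq_bigr => n _;
    rewrite !(rmorphXn, rmorphB, rmorphM, rmorphD) /=; ring.
set K := (k.+3 * k.+2)%N in r2.
(* The resultant identity is squared because only [d ^+ 2] is known. *)
have key : (4 ^ K * m ^ 2 = absz M ^ K * (2 ^ k.+2) ^ 2)%N.
  apply/eqP; rewrite -(eqr_nat C) natrM [X in _ == X]natrM !natrX -r2.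
  rewrite -[X in X ^+ _ * _](@normr_nat C 4) -M4.
  by rewrite normrM -intr_norm -abszE -pmulrn normrX exprMn exprAC; apply/eqP; ring.
have M0 : (0 < absz M)%N.
  rewrite absz_gt0; apply/negP => /eqP MN; move: M4; rewrite MN mulr0 => /eqP.
  by rewrite eq_sym pnatr_eq0.
have m0 : (0 < m)%N by case: m m_odd {mE r2 key}.
move/(congr1 (logn 2)): key.
rewrite lognM ?expn_gt0 ?m0 // [in RHS]lognM ?expn_gt0 ?M0 // !lognX.
rewrite (_ : 4 = 2 ^ 2)%N // lognX logn_prime //.
rewrite (@lognE 2 m) m0 dvdn2 m_odd /=.
by rewrite /K; case: (logn _ _) => [|[|v]]; nia.
Qed.

End JacobiPolynomials.

(** * Reflection symmetry *)

(** For symmetric [h] the reflected sequence satisfies the same second-order recurrence, so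
    agreement up to [eps] at two adjacent middle indices propagates down to 0. The upper half
    follows by reflecting again, as [eps ^+ 2 = 1]. *)
Lemma jac_mirror (C : numClosedFieldType) (h : nat -> C) (n k : nat) (l eps : C) :
  (forall i, (i <= n)%N -> h i = h (n - i)%N) -> eps ^+ 2 = 1 ->
  (k + k <= n.+1 <= (k + k).+1)%N ->
  (jac h (n.+2 - k)).[l] = eps * (jac h k).[l] ->
  (jac h (n.+1 - k)).[l] = eps * (jac h k.+1).[l] ->
  forall i, (i <= n.+2)%N -> (jac h (n.+2 - i)).[l] = eps * (jac h i).[l].
Proof.
move=> hsym eps2 /andP[kn nk] mk mk1.
have low e i : (i + e = k)%N ->
    (jac h (n.+2 - i)).[l] = eps * (jac h i).[l] /\
    (jac h (n.+1 - i)).[l] = eps * (jac h i.+1).[l].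
  elim: e i => [|e IHe] i; first by rewrite addn0 => ->.
  rewrite addnS -addSn => /[dup] iek /IHe []; rewrite subSS => mi1 mi2.
  split=> //; have [j jE] : exists j, (n - i)%N = j by eexists.
  have ni : (n.+2 - i = j.+2)%N by lia.
  have ni1 : (n.+1 - i = j.+1)%N by lia.
  have ni2 : (n.+1 - i.+1 = j)%N by lia.
  have hj : h j = h i by rewrite -jE -hsym //; lia.
  rewrite ni horner_jacSS hj -ni1 mi1 -ni2 mi2 horner_jacSS.
  by ring.
have lowk i : (i <= k.+1)%N -> (jac h (n.+2 - i)).[l] = eps * (jac h i).[l].
  rewrite leq_eqVlt => /orP[/eqP ->|]; first by rewrite subSS.
  by rewrite ltnS => /subnKC /low [].
move=> i ilt; case: (leqP i k.+1) => [|ik]; first exact: lowk.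
have := lowk (n.+2 - i)%N; rewrite subKn // => -> //; last by lia.
by rewrite mulrA -expr2 eps2 mul1r.
Qed.

(** * Tridiagonal matrices and unitaries commuting with them *)

Section TridiagonalMatrix.
Variables (C : numClosedFieldType) (h : nat -> C) (n : nat) (K : 'M[C]_n.+1).
Hypothesis KE : forall i j, K i j =
  (i.+1 == j :> nat)%:R + (j.+1 == i :> nat)%:R + (i == j)%:R * h i.

(** Coordinate [i] is stored as [F i.+1], so that [F 0] and [F n.+2] are border values; their
    vanishing makes one three-term formula valid at the end vertices too. *)
Lemma tridiag_sum (F : nat -> C) (j : 'I_n.+1) : F 0%N = 0 -> F n.+2 = 0 ->
  \sum_(i < n.+1) F i.+1 * K i j = F j + h j * F j.+1 + F j.+2.
Proof.
move=> F0 Fn.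
under eq_bigr => i _ do rewrite KE !mulrDr.
rewrite !big_split /= addrAC; congr (_ + _ + _).
- case: j => [[|j] jn] /=; first by rewrite F0 big1 // => i _; rewrite mulr0.
  rewrite (bigD1 (Ordinal (ltnW jn))) //= eqxx mulr1 big1 ?addr0 // => i.
  rewrite -val_eqE /= eqSS => /negPf ->; exact: mulr0.
- rewrite (bigD1 j) //= eqxx big1 ?addr0 ?mul1r 1?mulrC // => i /negPf ->.
  by rewrite mul0r mulr0.
- have [jn|jn] := ltnP j.+1 n.+1.
    rewrite (bigD1 (Ordinal jn)) //= eqxx mulr1 big1 ?addr0 // => i.
    rewrite -val_eqE /= eq_sym => /negPf ->; exact: mulr0.
  have -> : j = n :> nat by apply/eqP; rewrite eqn_leq -ltnS ltn_ord.
  rewrite Fn big1 // => i _; have := ltn_ord i.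
  by rewrite ltn_neqAle => /andP[/negPf + _]; rewrite eq_sym => ->; rewrite mulr0.
Qed.

Lemma tridiag_sym i j : K i j = K j i.
Proof.
have [-> //|ij] := eqVneq i j.
by rewrite !KE (eq_sym j i) (negPf ij) !mul0r !addr0 addrC.
Qed.

Lemma jac_eigenvector (l : C) : root (jac h n.+2) l ->
  (\row_(j < n.+1) (jac h j.+1).[l]) *m K = l *: \row_(j < n.+1) (jac h j.+1).[l].
Proof.
move=> /rootP jl; apply/rowP => j; rewrite !mxE.
under eq_bigr => i _ do rewrite mxE.
rewrite (@tridiag_sum (fun i => (jac h i).[l])) ?horner0 //.
by rewrite horner_jacSS; ring.
Qed.

Lemma unitary_row_eq0 m (U : 'M[C]_m) i j c : U \is unitarymx ->
  `|U i j| = 1 -> c != j -> U i c = 0.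
Proof.
move=> /unitarymxP /matrixP /(_ i i); rewrite !mxE eqxx mulr1n (bigD1 j) //= => Ui Uij cj.
have {}Ui : \sum_(k | k != j) `|U i k| ^+ 2 = 0.
  move: Ui; rewrite !mxE -normCK Uij expr1n => Ui.
  apply: (addrI 1); rewrite addr0 -[RHS]Ui; congr (_ + _).
  by apply: eq_bigr => k _; rewrite !mxE -normCK.
have /(_ c cj)/eqP := psumr_eq0P (fun k _ => exprn_ge0 2 (normr_ge0 (U i k))) Ui.
by rewrite expf_eq0 normr_eq0 /= => /eqP.
Qed.

(* With the zero boundary condition, commuting with [K] becomes a discrete
   wave equation, which propagates the corner entry along the antidiagonal. *)
Lemma commuting_unitary_antidiag (U : 'M[C]_n.+1) :
  U \is unitarymx -> K *m U = U *m K -> `|U ord0 ord_max| = 1 ->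
  (forall i j, U i j = U ord0 ord_max * (i + j == n)%N%:R) /\
  (forall i, (i <= n)%N -> h i = h (n - i)%N).
Proof.
move=> Uu KU; set gam := U ord0 ord_max => gam1.
(* [u] is [U] shifted by one in both indices and surrounded by a border of zeros. *)
pose u j c := if (0 < j <= n.+1)%N && (0 < c <= n.+1)%N
  then U (inord j.-1) (inord c.-1) else 0.
have uE (i j : 'I_n.+1) : u i.+1 j.+1 = U i j by rewrite /u !ltn_ord /= !inord_val.
have u0l c : u 0%N c = 0 by [].
have u0r j : u j 0%N = 0 by rewrite /u andbF.
have unl c : u n.+2 c = 0 by rewrite /u ltnn.
have unr j : u j n.+2 = 0 by rewrite /u ltnn !andbF.
have wave j c : (j <= n)%N -> (c <= n)%N ->
    u j c.+1 + h j * u j.+1 c.+1 + u j.+2 c.+1 =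
    u j.+1 c + h c * u j.+1 c.+1 + u j.+1 c.+2.
  move=> jn cn; have /matrixP/(_ (inord j) (inord c)) := KU; rewrite !mxE.
  under eq_bigr => i _ do rewrite -uE inordK // tridiag_sym mulrC.
  under [in RHS]eq_bigr => i _ do rewrite -uE inordK //.
  rewrite (@tridiag_sum (fun i => u i c.+1)) // (@tridiag_sum (fun i => u j.+1 i)) //.
  by rewrite !inordK.
have row0 j c c' : (j <= n)%N -> (c <= n)%N -> (c' <= n)%N -> c' != c ->
    `|u j.+1 c.+1| = 1 -> u j.+1 c'.+1 = 0.
  move=> jn cn c'n cc'; rewrite /u /= !ltnS jn cn c'n /= => uj.
  apply: unitary_row_eq0 Uu uj _.
  by rewrite -val_eqE /= !inordK.
have gam0 : gam != 0 by rewrite -normr_eq0 gam1 oner_neq0.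
(* The wave equation needs two consecutive rows as induction data. The border row [0] fits the
   formula, since [c = n.+2] is out of range. *)
have claim j : (j <= n)%N ->
  [/\ forall c, (c <= n.+1)%N -> u j c = gam * (c + j == n.+2)%N%:R,
      forall c, (c <= n.+1)%N -> u j.+1 c = gam * (c + j.+1 == n.+2)%N%:R &
      forall i, (i < j)%N -> h i = h (n - i)%N].
  elim: j => [_|j IHj jn].
    split=> // c cn.
      by rewrite u0l addn0 (ltn_eqF (cn : (c < n.+2)%N)) mulr0.
    case: c cn => [_|c cn]; first by rewrite u0r add0n mulr0.
    have gamE : u 1%N n.+1 = gam.
      by rewrite -[1%N]/((ord0 : 'I_n.+1).+1) -[n.+1]/((ord_max : 'I_n.+1).+1) uE.
    rewrite addn1 !eqSS; have [->|cn'] := eqVneq c n; first by rewrite gamE mulr1.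
    by rewrite mulr0 (row0 0%N n) ?gamE.
  have [u0 u1 hs] := IHj (ltnW jn).
  have step c : (c <= n)%N -> u j.+2 c.+1 =
      gam * ((c + j.+2 == n.+1)%N%:R + (h c - h j) * (c + j.+1 == n.+1)%N%:R).
    move=> cn; have := wave j c (ltnW jn) cn.
    have -> : u j.+1 c.+2 = gam * (c + j.+2 == n.+1)%N%:R.
      have [->|cn'] := eqVneq c n; last by rewrite u1; [congr (_ * _%:R); lia|lia].
      by rewrite unr (_ : (_ == _) = false) ?mulr0 //; lia.
    rewrite u0 // !u1 //; last by lia.
    rewrite (_ : (c.+1 + j == n.+2)%N = (c + j.+1 == n.+2)%N); last by lia.
    rewrite (_ : (c.+1 + j.+1 == n.+2)%N = (c + j.+1 == n.+1)%N); last by lia.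
    move=> eqw; apply: (addrI (gam * (c + j.+1 == n.+2)%:R +
      h j * (gam * (c + j.+1 == n.+1)%:R))); rewrite eqw; ring.
  (* The new row has [gam] on the antidiagonal, so unitarity kills its neighbor, whose value is
     [gam * (h (n - j) - h j)]. *)
  have hj : h j = h (n - j)%N.
    have uj : u j.+2 (n - j.+1).+1 = gam.
      rewrite step ?leq_subr // (_ : (_ + _ == _) = true); last by lia.
      by rewrite (_ : (_ + _ == _) = false) ?mulr0 ?addr0 ?mulr1 //; lia.
    have : u j.+2 (n - j).+1 = 0.
      by apply: (row0 _ (n - j.+1)%N); rewrite ?uj //; lia.
    rewrite step ?leq_subr // (_ : (_ + _ == _) = false); last by lia.
    rewrite (_ : (_ + _ == _) = true); last by lia.
    move/eqP; rewrite add0r mulr1 mulf_eq0 (negPf gam0) subr_eq0 => /eqP ->.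
    by [].
  split=> //.
    case=> [_|c cn]; first by rewrite u0r add0n (_ : (_ == _) = false) ?mulr0 //; lia.
    rewrite step //; congr (_ * _).
    rewrite (_ : (c.+1 + j.+2 == n.+2)%N = (c + j.+2 == n.+1)%N); last by lia.
    have [cj|cj] := eqVneq (c + j.+1)%N n.+1; last by rewrite mulr0 addr0.
    by rewrite (_ : c = n - j)%N -?hj ?subrr ?mul0r ?addr0 //; lia.
  move=> i; rewrite ltnS leq_eqVlt => /orP[/eqP -> //|]; exact: hs.
split=> [i j|i].
  have [_ /(_ j.+1) + _] := claim i (ltn_ord i : (i <= n)%N).
  by rewrite uE => -> //; congr (_ * _%:R); lia.
have [_ _ hs] := claim n (leqnn n).
rewrite leq_eqVlt => /orP[/eqP ->|]; last exact: hs.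
by rewrite subnn; case: (n) hs => [//|p] /(_ 0%N isT); rewrite subn0.
Qed.

End TridiagonalMatrix.

(** * The evolution operator *)

Section ComplexExponential.
Local Open Scope classical_set_scope.
Local Open Scope complex_scope.
Lemma lim_lincomb_mx (K : numFieldType) (n p : nat) (s : nat -> 'I_p -> K) (e : 'I_p -> K)
  (A : 'I_p -> 'M[K]_n) :
  (forall j (eps : K), 0 < eps -> \forall k \near \oo, `|e j - s k j| <= eps) ->
  limn (fun k => \sum_j s k j *: A j) = \sum_j e j *: A j.
Proof.
move=> se; apply: (@cvg_lim _); first exact: norm_hausdorff.
apply: cvg_big => [|j _]; first exact: add_continuous.
apply: cvgZr_tmp; apply/cvgrPdist_le => eps eps0; exact: se.
Qed.

Lemma cos_sin_coeffE (R : realType) (x : R) k :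
  (k`!%:R)^-1 * ('i * x%:C) ^+ k = (cos_coeff x k)%:C + 'i * (sin_coeff x k)%:C :> R[i].
Proof.
rewrite /cos_coeff /sin_coeff !(rmorphM, fmorphV, rmorphXn, rmorph_nat, rmorphN1).
have [n ->] : exists n, k = (odd k + n.*2)%N by exists k./2; rewrite odd_double_half.
case: (odd k);
  rewrite !exprMn !exprD -!mul2n !exprM sqrCi ?add0n ?add1n /= mul2n odd_double /=.
  by rewrite doubleK !mul0r expr1; ring.
by rewrite doubleK !mul0r mulr0 !expr0; ring.
Qed.

Definition expi (R : realType) (x : R) : R[i] := (cos x)%:C + 'i * (sin x)%:C.

Lemma cvg_expi (R : realType) (x : R) (eps : R[i]) : 0 < eps ->
  \forall n \near \oo, `|expi x -
     \sum_(0 <= k < n) (k`!%:R)^-1 * ('i * x%:C) ^+ k| <= eps.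
Proof.
move=> eps0.
(* A positive element of [R[i]] has zero imaginary part, so real estimates suffice. *)
have [r re] : {r : R | eps = r%:C}.
  exists (complex.Re eps); move: eps eps0 => [a b]; by rewrite ltcE /= => /andP[/eqP ->].
have r0 : 0 < r / 2 by rewrite divr_gt0// -ltcR -re.
have cx : series (cos_coeff x) @ \oo --> cos x.
  by rewrite unlock; exact: is_cvg_series_cos_coeff.
have sx : series (sin_coeff x) @ \oo --> sin x.
  by rewrite unlock; exact: is_cvg_series_sin_coeff.
move/cvgrPdist_le/(_ _ r0) in cx; move/cvgrPdist_le/(_ _ r0) in sx.
near=> n.
have -> : \sum_(0 <= k < n) (k`!%:R)^-1 * ('i * x%:C) ^+ k =
   (series (cos_coeff x) n)%:C + 'i * (series (sin_coeff x) n)%:C.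
  under eq_bigr do rewrite cos_sin_coeffE.
  by rewrite big_split -mulr_sumr /series /= !rmorph_sum.
rewrite /expi opprD addrACA -mulrBr -!rmorphB.
apply: le_trans (ler_normD _ _) _.
rewrite normrM normCi mul1r !normc_def /= !expr0n /= !addr0 !sqrtr_sqr.
rewrite re (splitr r) rmorphD lerD // lecR; near: n; [exact: cx|exact: sx].
Unshelve. all: by end_near. Qed.
End ComplexExponential.

(** * Exponentials through spectral projections *)

Section Evolution.
Variable R : realType.
Local Notation C := R[i].
Local Open Scope complex_scope.
Local Open Scope sesquilinear_scope.

(** The [A j] resolve the identity and [M] acts on each as a scalar, so every power, hence every
    partial sum of the series, is a combination of the fixed matrices [A j] with scalar exponential
    sums as coefficients. *)
Lemma expmx_eigen n p (M : 'M[C]_n) (A : 'I_p -> 'M[C]_n) (x : 'I_p -> R) :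
  \sum_j A j = 1%:M -> (forall j, M *m A j = ('i * (x j)%:C) *: A j) ->
  expmx M = \sum_j expi (x j) *: A j.
Proof.
move=> A1 MA.
have powM k : M ^+ k = \sum_j ('i * (x j)%:C) ^+ k *: A j.
  elim: k => [|k IHk].
    by rewrite expr0 -[1]/(1%:M) -A1; apply: eq_bigr => j _; rewrite expr0 scale1r.
  rewrite exprS IHk -[_ * _]/(M *m _) mulmx_sumr; apply: eq_bigr => j _.
  by rewrite -scalemxAr MA scalerA exprSr.
rewrite -(@lim_lincomb_mx _ n p
  (fun n j => \sum_(0 <= k < n) (k`!%:R)^-1 * ('i * (x j)%:C) ^+ k)); last first.
  by move=> j eps eps0; exact: cvg_expi.
have sE : series (fun k => (k`!%:R)^-1 *: M ^+ k) = (fun N =>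
    \sum_j (\sum_(0 <= k < N) (k`!%:R)^-1 * ('i * (x j)%:C) ^+ k) *: A j).
  apply/funext => N; rewrite /series /=; under eq_bigr do rewrite powM scaler_sumr.
  rewrite exchange_big; apply: eq_bigr => j _; rewrite scaler_suml.
  by apply: eq_bigr => k _; rewrite scalerA.
by rewrite /expmx sE.
Qed.

Lemma norm_expi (x : R) : `|expi x| = 1.
Proof.
have -> : expi x = cos x +i* sin x by rewrite /expi -complexiE; simpc.
by rewrite normc_def /= cos2Dsin2 sqrtr1.
Qed.

(** With [V] the unitary diagonalizing [K], [A j] is the conjugate of the [j]-th diagonal matrix
    unit. Combinations with coefficients [f] are conjugates of [diag_mx f], which yields the
    unitarity of the exponential. *)
Lemma spectral_projections n (K : 'M[C]_n) : K \is hermsymmx ->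
  exists (d : 'I_n -> R) (A : 'I_n -> 'M[C]_n),
  [/\ \sum_j A j = 1%:M,
      forall j, K *m A j = (d j)%:C *: A j,
      forall j, A j *m K = (d j)%:C *: A j &
      forall f : 'I_n -> C, (forall j, `|f j| = 1) ->
        \sum_j f j *: A j \is unitarymx].
Proof.
move=> K_herm; pose V := spectralmx K.
exists (fun j => complex.Re (spectral_diag K 0 j)).
exists (fun j => invmx V *m delta_mx j j *m V).
have sumE (f : 'I_n -> C) : \sum_j f j *: (invmx V *m delta_mx j j *m V) =
    invmx V *m diag_mx (\row_j f j) *m V.
  rewrite diag_mx_sum_delta mulmx_sumr mulmx_suml; apply: eq_bigr => j _.
  by rewrite mxE -scalemxAr -scalemxAl.
have Vu : V \in unitmx := spectral_unit K.
have KE : K = invmx V *m diag_mx (spectral_diag K) *m V.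
  by apply/orthomx_spectralP/hermitian_normalmx.
have dE j : (complex.Re (spectral_diag K 0 j))%:C = spectral_diag K 0 j.
  have /mxOverP/(_ 0 j) := hermitian_spectral_diag_real K_herm.
  by case: (spectral_diag K 0 j) => a b; rewrite complex_real /= => /eqP ->.
split=> [|j|j|f f1].
- rewrite -[RHS](mulVmx Vu) -[X in _ = X *m _]mulmx1.
  rewrite (_ : 1%:M = diag_mx (\row_j (1 : C))); last first.
    by apply/matrixP => i j; rewrite !mxE.
  by rewrite -sumE; apply: eq_bigr => j _; rewrite scale1r.
- rewrite {1}KE !mulmxA mulmxK // -[_ *m _ *m delta_mx _ _]mulmxA.
  suff -> : diag_mx (spectral_diag K) *m delta_mx j j =
      spectral_diag K 0 j *: delta_mx j j by rewrite dE -scalemxAr -scalemxAl.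
  apply/matrixP => a b; rewrite mul_diag_mx !mxE.
  by case: eqP => [->|]; rewrite ?mulr0.
- rewrite {1}KE !mulmxA mulmxK // -[_ *m _ *m diag_mx _]mulmxA.
  suff -> : delta_mx j j *m diag_mx (spectral_diag K) =
      spectral_diag K 0 j *: delta_mx j j by rewrite dE -scalemxAr -scalemxAl.
  apply/matrixP => a b; rewrite mul_mx_diag !mxE mulrC.
  by case: (b =P j) => [->|]; rewrite ?andbF ?mulr0.
rewrite sumE invmx_unitary ?spectral_unitarymx // !mul_unitarymx //.
- by rewrite trmxC_unitary spectral_unitarymx.
- apply/unitarymxP/matrixP => i j; rewrite tr_diag_mx map_diag_mx mulmx_diag !mxE.
  by rewrite -normCK f1 expr1n.
- exact: spectral_unitarymx.
Qed.

Variables (n : nat) (S : 'M[R]_n) (t : R).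
Hypothesis S_sym : S^T = S.
Let K : 'M[C]_n := map_mx (fun x : R => x%:C) S.
Let U := expmx (('i * t%:C) *: K).

Let K_herm : K \is hermsymmx.
Proof.
apply: realsym_hermsym.
  apply/is_hermitianmxP/matrixP => i j.
  by rewrite expr0 scale1r !mxE -[in LHS]S_sym mxE.
by apply/mxOverP => i j; rewrite mxE complex_real.
Qed.

Lemma expmx_unitary_commute :
  [/\ U \is unitarymx, K *m U = U *m K &
   forall (l : C) (w : 'rV_n), w != 0 -> w *m K = l *: w ->
     exists2 x : R, l = x%:C & w *m U = expi (t * x) *: w].
Proof.
have [d [A [A1 KA AK Au]]] := spectral_projections K_herm.
have UE : U = \sum_j expi (t * d j) *: A j.
  apply: expmx_eigen => // j; rewrite -scalemxAl KA scalerA rmorphM; congr (_ *: _).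
  by rewrite mulrA.
split.
- by rewrite UE; apply: Au => j; exact: norm_expi.
- rewrite UE mulmx_sumr mulmx_suml; apply: eq_bigr => j _.
  by rewrite -scalemxAl -scalemxAr KA AK.
move=> l w w0 wK.
have wA j : (d j)%:C *: (w *m A j) = l *: (w *m A j).
  by rewrite scalemxAr -KA mulmxA wK -scalemxAl.
(* Eigenvalues may repeat, so [w] may have several nonzero components, but all of them carry the
   same eigenvalue [l]. *)
have wA0 j : w *m A j != 0 -> (d j)%:C = l.
  move=> wj; apply/eqP; rewrite -subr_eq0; move/eqP: (wA j).
  by rewrite -subr_eq0 -scalerBl scaler_eq0 (negPf wj) orbF.
have [j wj] : exists j, w *m A j != 0.
  apply/existsP; apply: contraNT w0 => /existsPn wA_0.
  rewrite -[w]mulmx1 -A1 mulmx_sumr big1 // => j _.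
  by apply/eqP/negPn/wA_0.
exists (d j); first by rewrite wA0.
rewrite UE -[w in RHS]mulmx1 -A1 !mulmx_sumr scaler_sumr; apply: eq_bigr => i _.
rewrite -scalemxAr; have [->|wi] := eqVneq (w *m A i) 0; first by rewrite !scaler0.
by congr (expi (t * _) *: _); apply: complexI; rewrite !wA0.
Qed.

End Evolution.

(** * Phases and the theorem *)

(** Reduce to [z] in one period [[0, 2 pi)]. Injectivity of [cos] on [[0, pi]] gives [z = 0]; beyond
    [pi], applied to [2 pi - z], it contradicts [z < 2 pi]. *)
Lemma cos_eq1 (R : realType) (x : R) : cos x = 1 -> exists n : int, x = pi * (2 * n)%:~R.
Proof.
wlog x0 : x / 0 <= x => [hw|cosx].
  have [|xlt0] := leP 0 x; first exact: hw.
  rewrite -cosN => /hw []; first by rewrite oppr_ge0 ltW.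
  by move=> n nE; exists (- n); rewrite mulrN rmorphN mulrN -nE opprK.
have pi0 : 0 < pi *+ 2 :> R by rewrite pmulrn_rgt0 ?pi_gt0.
have /andP[] := truncn_itv (divr_ge0 x0 (ltW pi0)).
set n := Num.truncn _; rewrite ler_pdivlMr // ltr_pdivrMr // => nx xn.
pose z := x - n%:R * (pi *+ 2).
have xE : x = z + pi *+ 2 *+ n by rewrite /z -[in X in _ + X]mulr_natl subrK.
have z0 : 0 <= z by rewrite subr_ge0.
have z2 : z < pi *+ 2 by move: xn; rewrite ltrBlDr -natr1 mulrDl mul1r addrC.
have cosz : cos z = 1 by rewrite -cosx xE (periodicn (@cosD2pi R)).
have in0 : (0 : R) \in `[0, pi] by rewrite in_itv /= lexx pi_ge0.
have [zpi|piz] := leP z pi.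
  have zE : z = 0 by apply: cos_inj; rewrite ?cosz ?cos0 // in_itv /= z0.
  by exists n; rewrite xE zE add0r -mulrnA -[LHS]mulr_natr natrM intrM.
have : pi *+ 2 - z = 0.
  apply: cos_inj => //; last by rewrite cos0 cosB cos2pi sin2pi cosz mulr1 mul0r addr0.
  by rewrite in_itv /= subr_ge0 (ltW z2) /= lerBlDr mulr2n lerD2l ltW.
by move/eqP; rewrite subr_eq0 gt_eqF.
Qed.

Lemma expi_inj (R : realType) (x y : R) : expi x = expi y ->
  exists n : int, x = y + pi * (2 * n)%:~R.
Proof.
have E z : expi z = (cos z +i* sin z)%C by rewrite /expi -complexiE; simpc.
rewrite !E => -[cxy sxy].
have [|n nE] := @cos_eq1 R (x - y); last by exists n; rewrite -nE addrC subrK.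
by rewrite cosB cxy sxy -!expr2 cos2Dsin2.
Qed.

Lemma expiDpi (R : realType) (x : R) : expi (x + pi) = - expi x.
Proof. by rewrite /expi sinDpi cosDpi !rmorphN /= mulrN opprD. Qed.

Lemma closed_root_exists (C : closedFieldType) (p : {poly C}) :
  (1 < size p)%N -> exists x, root p x.
Proof. by move=> sp; apply/closed_rootP; rewrite gtn_eqF. Qed.

Theorem theorem1 (R : realType) (m : nat) (Hm : (4 <= m)%N)
  (Q : 'M[R]_m) (HQ : is_diag_mx Q) (u v : 'I_m)
  (Hu : nat_of_ord u = 0%N) (Hv : nat_of_ord v = m.-1) :
  forall T : R, ~ PST Q u v T.
Proof.
move=> T; case: m Hm Q HQ u v Hu Hv => [//|n] n3 Q Qd u v u0 vn.
have -> : u = ord0 by apply: val_inj.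
have -> : v = ord_max by apply: val_inj.
rewrite /PST /evol => {u v u0 vn} pst.
pose S := path_adj R n.+1 - Q.
have Ssym : S^T = S.
  apply/matrixP => i j; rewrite !mxE orbC; congr (_ - _).
  by have [-> //|ij] := eqVneq i j; rewrite !(is_diag_mxP Qd) // eq_sym.
pose h k : R[i] := (- Q (inord k) (inord k))%:C%C.
have KE (i j : 'I_n.+1) : hamiltonian Q i j =
    (i.+1 == j :> nat)%:R + (j.+1 == i :> nat)%:R + (i == j)%:R * h i.
  rewrite !mxE rmorphB rmorph_nat /h inord_val.
  have -> : ((i.+1 == j :> nat) || (j.+1 == i :> nat))%:R =
     (i.+1 == j :> nat)%:R + (j.+1 == i :> nat)%:R :> R[i].
    by have [<-|_] := eqVneq i.+1 (j : nat); rewrite ?add0r // gtn_eqF ?addr0 //; lia.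
  congr (_ + _); have [->|ij] := eqVneq i j; first by rewrite mul1r rmorphN.
  by rewrite (is_diag_mxP Qd) // rmorph0 oppr0 mul0r.
have [Uu KU Uw] := @expmx_unitary_commute R n.+1 S T Ssym.
have [UE hsym] := commuting_unitary_antidiag KE Uu KU pst.
set gam := fun_of_matrix _ ord0 ord_max in UE.
(* The mirrored eigenvector [w] starts with 1 and ends with [eps]. Since [U] is [gam] times the
   reflection, the last coordinate of [w *m U] is [gam], to be compared with
   [expi (T * x) * eps]. *)
have phase k eps l : eps ^+ 2 = 1 -> (k + k <= n.+1 <= (k + k).+1)%N ->
   (jac h (n.+2 - k)).[l] = eps * (jac h k).[l] ->
   (jac h (n.+1 - k)).[l] = eps * (jac h k.+1).[l] ->
   exists2 x : R, l = x%:C%C & expi (T * x) = eps * gam.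
  move=> eps2 kn mk mk1.
  have mirror := jac_mirror hsym eps2 kn mk mk1.
  have jn0 : root (jac h n.+2) l.
    by apply/rootP; have := mirror 0%N isT; rewrite subn0 horner0 mulr0.
  have jn1 : (jac h n.+1).[l] = eps.
    by have := mirror 1%N isT; rewrite subn1 hornerC mulr1.
  have wK := jac_eigenvector KE jn0; set w := \row_j _ in wK.
  have w0 : w != 0.
    apply/eqP => /rowP/(_ ord0); rewrite !mxE hornerC => /eqP; exact/negP/oner_neq0.
  have [x lE wU] := Uw l w w0 wK; exists x => //.
  have := congr1 (fun M : 'rV_n.+1 => M ord0 ord_max) wU; rewrite !mxE jn1.
  rewrite (bigD1 ord0) //= UE eqxx mulr1 mxE hornerC mul1r big1 ?addr0.
    by move=> ->; rewrite mulrCA -expr2 eps2 mulr1.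
  move=> i i0; rewrite UE (_ : (_ == _) = false) ?mulr0 //.
  by move: i0; rewrite -val_eqE /=; lia.
pose k := (n.+1)./2.
have noT (P N : {poly R[i]}) : (1 < size P)%N -> (1 < size N)%N ->
  (forall l, root P l -> exists2 x : R, l = x%:C%C & expi (T * x) = gam) ->
  (forall l, root N l -> exists2 x : R, l = x%:C%C & expi (T * x) = - gam) ->
  exists x0 d : R[i],
   (forall l, root P l -> exists n : int, l = x0 + d * (2 * n + 1)%:~R) /\
   (forall l, root N l -> exists n : int, l = x0 + d * (2 * n)%:~R).
  move=> sP sN rP rN.
  have [y0 /rN [x0 _ x0E]] := closed_root_exists sN.
  have [y1 /rP [x1 _ x1E]] := closed_root_exists sP.
  (* At [T = 0] both phases would be 1, forcing [gam = - gam]. *)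
  have T0 : T != 0.
    apply/eqP => T0; move: x0E; rewrite -x1E T0 !mul0r => /eqP.
    by rewrite eq_sym eqNr -normr_eq0 norm_expi oner_eq0.
  (* The base point is an antisymmetric eigenvalue; symmetric ones have opposite phase, hence lie at
     odd multiples of [pi / T] from it. *)
  exists x0%:C%C, (pi / T)%:C%C; split=> l.
    move=> /rP [x -> xE]; have [|a aE] := @expi_inj R (T * x) (T * x0 + pi).
      by rewrite expiDpi x0E opprK.
    have -> : x = x0 + pi / T * (2 * a + 1)%:~R.
      by rewrite -(mulKf T0 x) aE rmorphD /=; field.
    by exists a; rewrite rmorphD rmorphM rmorph_int.
  move=> /rN [x -> xE]; have [|a aE] := @expi_inj R (T * x) (T * x0).
    by rewrite xE x0E.
  have -> : x = x0 + pi / T * (2 * a)%:~R by rewrite -(mulKf T0 x) aE; field.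
  by exists a; rewrite rmorphD rmorphM rmorph_int.
have k1 : (1 < k)%N by rewrite /k; lia.
have [odd_m|even_m] := boolP (odd n.+1).
  have nk : n.+1 = (k + k).+1 by rewrite /k -{1}(odd_double_half n.+1) odd_m -addnn.
  (* For odd order the middle index [k.+1] is its own mirror: its condition is empty for [eps = 1]
     and reads [jac k.+1 = 0] for [eps = -1], which implies the other one. *)
  have [| | | |x0 [d [rP rN]]] := noT (jac h k.+2 - jac h k) (jac h k.+1).
  - by rewrite size_polyDl ?size_polyN !size_jac.
  - by rewrite size_jac; lia.
  - move=> l /rootP; rewrite hornerD hornerN => /subr0_eq jl.
    have [||||x lE xE] := phase k 1 l; rewrite ?expr1n ?nk ?leqnn ?andbT //.
    + by rewrite (_ : _ - k = k.+2)%N ?mul1r //; lia.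
    + by rewrite (_ : _ - k = k.+1)%N ?mul1r //; lia.
    + by exists x; rewrite ?xE ?mul1r.
  - move=> l /rootP jl.
    have [||||x lE xE] := phase k (-1) l; rewrite ?sqrrN ?expr1n ?nk ?leqnn ?andbT //.
    + by rewrite (_ : _ - k = k.+2)%N ?horner_jacSS ?jl ?mulr0 ?sub0r ?mulN1r //; lia.
    + by rewrite (_ : _ - k = k.+1)%N ?jl ?mulr0 //; lia.
    + by exists x; rewrite ?xE ?mulN1r.
  exact: no_progression_odd k1 rP rN.
have nk : n.+1 = (k + k)%N by rewrite /k -{1}(odd_double_half n.+1) (negPf even_m) -addnn.
(* For even order the indices [k] and [k.+1] are swapped, so both middle conditions amount to
   [jac k.+1 = eps * jac k]. *)
have [| | | |x0 [d [rP rN]]] := noT (jac h k.+1 - jac h k) (jac h k.+1 + jac h k).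
- by rewrite size_polyDl ?size_polyN !size_jac //; lia.
- by rewrite size_polyDl ?size_polyN !size_jac //; lia.
- move=> l /rootP; rewrite hornerD hornerN => /subr0_eq jl.
  have [||||x lE xE] := phase k 1 l; rewrite ?expr1n ?nk ?leqnn ?leqnSn //.
  + by rewrite (_ : _ - k = k.+1)%N ?mul1r //; lia.
  + by rewrite (_ : _ - k = k)%N ?mul1r //; lia.
  + by exists x; rewrite ?xE ?mul1r.
- move=> l /rootP; rewrite hornerD => /eqP; rewrite addr_eq0 => /eqP jl.
  have [||||x lE xE] := phase k (-1) l; rewrite ?sqrrN ?expr1n ?nk ?leqnn ?leqnSn //.
  + by rewrite (_ : _ - k = k.+1)%N ?jl ?mulN1r //; lia.
  + by rewrite (_ : _ - k = k)%N ?jl ?mulN1r ?opprK //; lia.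
  + by exists x; rewrite ?xE ?mulN1r.
exact: no_progression_even k1 rP rN.
Qed.
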